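(* The Banks set $\mathrm{BA}=S_{\mathcal{M}^*}$ satisfies strong retentiveness, and for every tournament solution $S$ satisfying strong retentiveness, $\mathrm{BA}(T)\subseteq S(T)$ for all tournaments $T$. Consequently, $\mathrm{BA}\subseteq S_\mathcal{Q}$ for every concept of qualified subsets $\mathcal{Q}$, i.e. the Banks set is the finest tournament solution definable via qualified subsets.
   Context: Let $X$ be a universe of alternatives and $\mathcal{F}(X)$ the non-empty finite subsets of $X$. A tournament $T=(A,\succ)$: $A\in\mathcal{F}(X)$, $\succ$ an asymmetric complete relation on $X$. For $B\subseteq A$ write $B$ also for $(B,\succ)$; $B\succ C$ means $b\succ c$ for all $b\in B,c\in C$; $\overline{D}(a)=\{b\in A:b\succ a\}$; $\max_\prec(B)=\{a\in B:\text{no }b\in B\text{ with }b\succ a\}$. A tournament function depends only on $A$ and $\succ|_A$ and commutes with isomorphisms; a tournament solution is a tournament function $S$ with $\max_\prec(A)\subseteq S(T)\subseteq A$, $S(T)\neq\emptyset$. $\mathcal{M}(T)=\{B\subseteq A:\max_\prec(B)\ne\emptyset\}$; $\mathcal{M}^*(T)=\{B\subseteq A:\max_\prec(C)\neq\emptyset$ for every non-empty $C\subseteq B\}$; $\mathcal{M}_1(T)$ the singletons. A concept of qualified subsets is a tournament function $\mathcal{Q}$ with $\mathcal{M}_1(T)\subseteq\mathcal{Q}(T)\subseteq\mathcal{M}(T)$ satisfying (Closure) $Q\in\mathcal{Q}(T)$, $Q'\subseteq Q$, $Q'\in\mathcal{M}(T)$ imply $Q'\in\mathcal{Q}(T)$;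 (Independence) for $A'\in\mathcal{F}(X)$, $Q\subseteq A\cap A'$: $Q\in\mathcal{Q}((A,\succ))$ iff $Q\in\mathcal{Q}((A',\succ))$; (Fusion) $Q_1,Q_2\in\mathcal{Q}(T)$ and $Q_1\setminus Q_2\succ Q_2$ imply $Q_1\cup Q_2\in\mathcal{Q}(T)$ provided some tournament $T'$ has $Q\in\mathcal{Q}(T')$ with $|Q_1\cup Q_2|\le|Q|$. $S_\mathcal{Q}(T)=\bigcup\{\max_\prec(B):B\text{ inclusion-maximal in }\mathcal{Q}(T)\}$; the Banks set is $\mathrm{BA}=S_{\mathcal{M}^*}$ (maximal elements of inclusion-maximal transitive subsets). Strong retentiveness of $S$: $S(\overline{D}(a))\subseteq S(A)$ for all tournaments $(A,\succ)$ and all $a\in A$ with $\overline{D}(a)\ne\emptyset$. *)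

(* Defs.v *)
From HB Require Import structures.
From mathcomp Require Import all_boot.
From mathcomp Require Import finmap.

Set Implicit Arguments.
Unset Strict Implicit.
Unset Printing Implicit Defensive.

Local Open Scope fset_scope.

(* Only [alts] is required to be finite: the dominance relation lives on the
   whole, possibly infinite, universe X. *)
Record tournament (X : choiceType) := Tournament {
  alts : {fset X};
  dom : rel X;
  alts_neq0 : alts != fset0;
  dom_asym : forall a b : X, dom a b -> ~~ dom b a;
  dom_complete : forall a b : X, a != b -> dom a b || dom b a
}.

(* The tournament (B, dom T); B need not be included in alts T. *)
Definition restrict (X : choiceType) (T : tournament X) (B : {fset X})
    (B_neq0 : B != fset0) : tournament X :=
  Tournament B_neq0 (@dom_asym X T) (@dom_complete X T).

Section Notions.
Variable X : choiceType.
Implicit Types (T : tournament X) (B C : {fset X}) (F : {fset {fset X}}).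
Implicit Types (S : tournament X -> {fset X}).
Implicit Types (Q : tournament X -> {fset {fset X}}).

Definition dominates T B C : Prop :=
  forall b c : X, b \in B -> c \in C -> dom T b c.

Definition dominators T (a : X) : {fset X} := [fset b in alts T | dom T b a].

Definition maxelts T B : {fset X} :=
  [fset a in B | ~~ has (fun b => dom T b a) B].

(* Isomorphisms are represented by total maps on X of which only the values on
   alts T are relevant. *)
Definition isomorphism T T' (h : X -> X) : Prop :=
  [/\ {in alts T &, injective h},
      h @` alts T = alts T'
    & {in alts T &, forall a b, dom T a b = dom T' (h a) (h b)}].

(* Covers set-valued and family-valued functions at once: [act h] is the
   extension of h to the type V of values. *)
Definition tournament_function (V : Type) (act : (X -> X) -> V -> V)
    (f : tournament X -> V) : Prop :=
  (forall T T', alts T = alts T' ->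
     {in alts T &, forall a b, dom T a b = dom T' a b} -> f T = f T') /\
  (forall T T' (h : X -> X), isomorphism T T' h -> f T' = act h (f T)).

Definition act_set (h : X -> X) B : {fset X} := h @` B.
Definition act_family (h : X -> X) F : {fset {fset X}} := act_set h @` F.

Definition tournament_solution S : Prop :=
  tournament_function act_set S /\
  (forall T, [/\ maxelts T (alts T) `<=` S T, S T `<=` alts T & S T != fset0]).

Definition strongly_retentive S : Prop :=
  forall T (a : X) (D_neq0 : dominators T a != fset0),
    a \in alts T -> S (restrict T D_neq0) `<=` S T.

Definition Msets T : {fset {fset X}} :=
  [fset B in fpowerset (alts T) | maxelts T B != fset0].

(* fset0 belongs to Mstar T (vacuously) but not to Msets T. *)
Definition Mstar T : {fset {fset X}} :=
  [fset B in fpowerset (alts T) |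
    all (fun C => (C != fset0) ==> (maxelts T C != fset0)) (fpowerset B)].

Definition M1 T : {fset {fset X}} := [fset [fset a] | a in alts T].

Record qualified_concept Q : Prop := QualifiedConcept {
  qc_function : tournament_function act_family Q;
  qc_singletons : forall T, M1 T `<=` Q T;
  qc_Msets : forall T, Q T `<=` Msets T;
  qc_closure : forall T B C,
    B \in Q T -> C `<=` B -> C \in Msets T -> C \in Q T;
  qc_independence : forall T (A' : {fset X}) (A'_neq0 : A' != fset0) B,
    B `<=` alts T `&` A' -> (B \in Q T <-> B \in Q (restrict T A'_neq0));
  qc_fusion : forall T B C,
    B \in Q T -> C \in Q T -> dominates T (B `\` C) C ->
    (exists T' (D : {fset X}), D \in Q T' /\ #|` B `|` C| <= #|` D|) ->
    B `|` C \in Q T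
}.

Definition inclusion_maximal F B : bool :=
  (B \in F) && all (fun C => (B `<=` C) ==> (C == B)) F.

Definition solution_of Q T : {fset X} :=
  \bigcup_(B <- Q T | inclusion_maximal (Q T) B) maxelts T B.

Definition Banks : tournament X -> {fset X} := solution_of Mstar.

Definition definable_by_qualified_subsets S : Prop :=
  exists Q, qualified_concept Q /\ (forall T, S T = solution_of Q T).

End Notions.

(* Main.v *)
(* If [B] is a qualified subset of the dominators of [a], then [B] dominates
   [a], so Fusion makes [B] together with [a] qualified in the whole tournament
   unless [B] is already of the largest possible size; either way the maximum
   of a maximal such [B] is chosen in the whole tournament, and every S_Q is
   strongly retentive.  Conversely, let [b] be the top of a maximal transitive
   set [B] with bottom element [m].  Then [B] without [m] is maximal transitive
   among the dominators of [m], so by induction on the number of alternatives a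
   strongly retentive S chooses [b] among these dominators, and hence in the
   whole tournament; the induction ends when [B] is a singleton, that is, when
   [b] is a Condorcet winner. *)
Require Import Defs.
From mathcomp Require Import all_boot.
From mathcomp Require Import finmap.

Set Implicit Arguments.
Unset Strict Implicit.
Unset Printing Implicit Defensive.

Local Open Scope fset_scope.

(** Among the members of [F] containing [B], one of largest cardinality cannot be properly extended
    inside [F]. *)
Lemma exists_inclusion_maximal (X : choiceType) (F : {fset {fset X}}) (B : {fset X}) :
  B \in F -> exists2 C, inclusion_maximal F C & B `<=` C.
Proof.
move=> BF.
case: (@arg_maxnP F [` BF] (fun C => B `<=` val C) (fun C => #|` val C|)) => //=.
move=> C BC maxC; exists (val C) => //.
apply/andP; split; first exact: valP.
apply/allP => D DF; apply/implyP => CD.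
rewrite eq_sym eqEfcard CD /=.
exact: (maxC [` DF]) (fsubset_trans BC CD).
Qed.

(** * Maximal elements, dominators and transitive subsets *)

Section Tournament.
Variables (X : choiceType) (T : tournament X).
Implicit Types (B C : {fset X}).

Lemma in_maxelts B a :
  reflect (a \in B /\ forall b, b \in B -> ~~ dom T b a) (a \in maxelts T B).
Proof.
rewrite !inE /=; apply: (iffP andP) => -[aB Ba]; split=> //.
  by move=> b bB; apply: contra Ba => ba; apply/hasP; exists b.
by apply/hasPn.
Qed.

Lemma maxelts_sub B : maxelts T B `<=` B.
Proof. by apply/fsubsetP => a /in_maxelts[]. Qed.

Lemma maxelts_subset B C a :
  B `<=` C -> a \in B -> a \in maxelts T C -> a \in maxelts T B.
Proof.
move=> /fsubsetP BC aB /in_maxelts[_ Ca]; apply/in_maxelts.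
by split=> // b /BC /Ca.
Qed.

Lemma dom_maxelts B a b : a \in maxelts T B -> b \in B -> b != a -> dom T a b.
Proof.
move=> /in_maxelts[_ Ba] bB nba.
by have := dom_complete T nba; rewrite (negPf (Ba b bB)).
Qed.

Lemma maxelts_unique B a b :
  a \in maxelts T B -> b \in maxelts T B -> a = b.
Proof.
move=> aB bB; apply/eqP/negP => /negP nab.
have /in_maxelts[/(dom_maxelts bB)/(_ nab) ba _] := aB.
by case/in_maxelts: aB => _ /(_ b) /(_ (fsubsetP (maxelts_sub B) b bB)); rewrite ba.
Qed.

Lemma domxx a : dom T a a = false.
Proof. by apply/negP => aa; have := dom_asym aa; rewrite aa. Qed.

Lemma maxelts1 a : maxelts T [fset a] = [fset a].
Proof.
apply/eqP; rewrite eqEfsubset maxelts_sub fsub1set; apply/in_maxelts.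
by split=> [|b]; rewrite !inE // => /eqP->; rewrite domxx.
Qed.

Lemma maxeltsU B C a :
  dominates T (B `\` C) C -> a \in maxelts T B -> a \notin C ->
  a \in maxelts T (B `|` C).
Proof.
move=> BC /in_maxelts[aB Ba] aC; apply/in_maxelts.
split=> [|b]; first by rewrite inE aB.
rewrite inE => /orP[/Ba //|bC]; apply: dom_asym.
by apply: BC => //; rewrite inE aC aB.
Qed.

Lemma in_dominators a b :
  (b \in dominators T a) = (b \in alts T) && dom T b a.
Proof. by rewrite !inE. Qed.

Lemma dominators_sub a : dominators T a `<=` alts T.
Proof. by apply/fsubsetP => b; rewrite in_dominators => /andP[]. Qed.

Lemma dominators_proper a : a \in alts T -> dominators T a `<` alts T.
Proof.
move=> aT; rewrite fproperEneq dominators_sub andbT.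
by apply/eqP => eqD; move: aT; rewrite -eqD in_dominators domxx andbF.
Qed.

Lemma in_Msets B :
  (B \in Msets T) = (B `<=` alts T) && (maxelts T B != fset0).
Proof. by rewrite !inE /= fpowersetE. Qed.

Lemma in_Mstar B :
  reflect (B `<=` alts T /\
           forall C, C `<=` B -> C != fset0 -> maxelts T C != fset0)
          (B \in Mstar T).
Proof.
rewrite !inE /= fpowersetE; apply: (iffP andP) => -[BT CB]; split=> //.
  by move=> C sCB; apply/implyP/(allP CB); rewrite fpowersetE.
by apply/allP => C; rewrite fpowersetE => /CB H; apply/implyP.
Qed.

Lemma Mstar_sub B C : B \in Mstar T -> C `<=` B -> C \in Mstar T.
Proof.
move=> /in_Mstar[BT Bmax] CB; apply/in_Mstar; split.
  exact: fsubset_trans BT.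
by move=> D DC; apply/Bmax/(fsubset_trans DC).
Qed.

Lemma Mstar_set1 a : a \in alts T -> [fset a] \in Mstar T.
Proof.
move=> aT; apply/in_Mstar; split; first by rewrite fsub1set.
by move=> C; rewrite fsubset1 => /orP[]/eqP->; rewrite ?eqxx // maxelts1.
Qed.

(** If a non-empty subset [D] of the union is not inside [C], its part outside [C] has a maximum by
    transitivity of [B], and that element also dominates [C]. *)
Lemma Mstar_fusion B C :
  B \in Mstar T -> C \in Mstar T -> dominates T (B `\` C) C ->
  B `|` C \in Mstar T.
Proof.
move=> /in_Mstar[BT Bmax] /in_Mstar[CT Cmax] BC; apply/in_Mstar.
split=> [|D DBC D0]; first by rewrite fsubUset BT CT.
have [DC|] := boolP (D `<=` C); first exact: Cmax.
rewrite -fsetD_eq0 => DC0.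
have DCB : D `\` C `<=` B by rewrite fsubDset fsetUC.
have /fset0Pn[a aDC] := Bmax _ DCB DC0.
apply/fset0Pn; exists a.
have /andP[aC aD] : (a \notin C) && (a \in D).
  by have := fsubsetP (maxelts_sub _) a aDC; rewrite inE.
have H : dominates T ((D `\` C) `\` C) C.
  move=> x y; rewrite !inE => /and3P[xC _ xD] yC.
  by apply: BC => //; rewrite inE xC /= (fsubsetP DCB) // inE xC.
(* [a] is maximal even in the union of [D] and [C], hence in [D]. *)
apply: maxelts_subset (maxeltsU H aDC aC) => //.
by apply/fsubsetP => x xD; rewrite !inE xD andbT; case: (x \in C).
Qed.

(** Remove the maximum [b] of [B]: it dominates the minimum of the rest, which is therefore the
    minimum of [B]. When nothing is left, [b] itself serves. *)
Lemma Mstar_minimum B :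
  B \in Mstar T -> B != fset0 ->
  exists2 m, m \in B & dominates T (B `\ m) [fset m].
Proof.
elim/finSet_rect: B => B IH BM B0.
have /in_Mstar[_ /(_ B (fsubset_refl B) B0) /fset0Pn[b bB]] := BM.
have bB' := fsubsetP (maxelts_sub B) b bB.
have [Bb0|Bb0] := eqVneq (B `\ b) fset0.
  by exists b => // x y; rewrite Bb0 inE.
have [m mBb mmin] := IH _ (fproperD1 bB') (Mstar_sub BM (fsubsetDl _ _)) Bb0.
move: mBb; rewrite !inE => /andP[mb mB]; exists m => // x y.
rewrite !inE => /andP[xm xB] /eqP->.
have [->|xb] := eqVneq x b; first exact: dom_maxelts bB mB mb.
by apply: mmin; rewrite !inE ?eqxx // xm xb xB.
Qed.

Lemma solution_ofP (Q : tournament X -> {fset {fset X}}) a :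
  reflect (exists2 B, inclusion_maximal (Q T) B & a \in maxelts T B)
          (a \in solution_of Q T).
Proof.
apply: (iffP (bigfcupP _ _ _ _)) => -[B]; first by case/andP=> _; exists B.
by move=> Bmax aB; exists B; rewrite ?Bmax ?andbT //; case/andP: Bmax.
Qed.

End Tournament.

Lemma inclusion_maximal_eq (X : choiceType) (F : {fset {fset X}}) (B C : {fset X}) :
  inclusion_maximal F B -> C \in F -> B `<=` C -> C = B.
Proof. by case/andP=> _ /allP/(_ C) H /H/implyP{}H /H/eqP. Qed.

(** The identity is an isomorphism between tournaments that agree on their common alternatives, so
    the first clause of [tournament_function] is a case of the second. *)
Lemma tournament_function_of_iso (X : choiceType) (V : Type)
    (act : (X -> X) -> V -> V) (f : tournament X -> V) :
  (forall v, act id v = v) ->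
  (forall T T' h, isomorphism T T' h -> f T' = act h (f T)) ->
  tournament_function act f.
Proof.
move=> act1 fiso; split=> // T T' eqA eqdom.
rewrite (fiso T T' id) ?act1 //; split=> //.
by apply/fsetP => x; rewrite -eqA; apply/imfsetP/idP => [[y yA ->]|xA] //; exists x.
Qed.

Lemma act_set_id (X : choiceType) (B : {fset X}) : act_set id B = B.
Proof. by apply/fsetP => x; apply/imfsetP/idP => [[y yB ->]|xB] //; exists x. Qed.

Lemma act_family_id (X : choiceType) (F : {fset {fset X}}) : act_family id F = F.
Proof.
apply/fsetP => B; apply/imfsetP/idP => [[C CF ->]|BF].
  by rewrite act_set_id.
by exists B; rewrite ?act_set_id.
Qed.

(** * Transport along isomorphisms *)

Section Isomorphism.
Variables (X : choiceType) (T T' : tournament X) (h : X -> X).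
Hypothesis iso : isomorphism T T' h.
Implicit Types (B C : {fset X}) (F : {fset {fset X}}).

Lemma in_act_set B a :
  B `<=` alts T -> a \in alts T -> (h a \in act_set h B) = (a \in B).
Proof.
case: iso => hinj _ _ /fsubsetP BT aT; apply/imfsetP/idP => [[b bB /hinj->]|aB] //.
  exact: BT.
by exists a.
Qed.

(** Carries inclusion-maximality across [h] in both directions. Injectivity of [h] is known on
    [alts T] only, so both sets are kept inside it. *)
Lemma act_setS B C :
  B `<=` alts T -> C `<=` alts T -> (act_set h B `<=` act_set h C) = (B `<=` C).
Proof.
move=> BT CT; apply/fsubsetP/fsubsetP => [BC a aB|BC _ /imfsetP[a /= aB ->]].
  have aT := fsubsetP BT a aB.
  by rewrite -in_act_set // BC // in_act_set.
by rewrite in_act_set ?BC // (fsubsetP BT).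
Qed.

Lemma act_set_inj B C :
  B `<=` alts T -> C `<=` alts T -> act_set h B = act_set h C -> B = C.
Proof.
move=> BT CT eqBC; apply/eqP.
by rewrite eqEfsubset -[B `<=` C]act_setS // -[C `<=` B]act_setS // eqBC fsubset_refl.
Qed.

Lemma act_set_sub_alts B : B `<=` alts T -> act_set h B `<=` alts T'.
Proof. by case: iso => _ <- _ BT; rewrite act_setS. Qed.

(** Lets a statement about all subsets of [alts T'] be pulled back to subsets of [alts T]. *)
Lemma act_set_preim C :
  C `<=` alts T' -> exists2 B, B `<=` alts T & C = act_set h B.
Proof.
case: iso => _ eqA _ /fsubsetP CT.
exists [fset x in alts T | h x \in C].
  by apply/fsubsetP => x; rewrite !inE => /andP[].
apply/fsetP => y; apply/idP/imfsetP => [yC|[x /=]].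
  have := CT y yC; rewrite -eqA => /imfsetP[x /= xT yhx].
  by exists x; rewrite // !inE xT -yhx.
by rewrite !inE => /andP[_ hx] ->.
Qed.

Lemma maxelts_act B :
  B `<=` alts T -> maxelts T' (act_set h B) = act_set h (maxelts T B).
Proof.
case: iso => hinj eqA hdom BT.
have BA x : x \in B -> x \in alts T by apply: (fsubsetP BT).
apply/fsetP => y; apply/in_maxelts/imfsetP => [[/imfsetP[x /= xB ->] ymax]|[x /=]].
  exists x => //; apply/in_maxelts; split=> // b bB.
  by rewrite hdom ?BA //; apply: ymax; rewrite in_act_set ?BA.
move=> /in_maxelts[xB xmax] ->; split; first by rewrite in_act_set ?BA.
by move=> _ /imfsetP[b /= bB ->]; rewrite -hdom ?BA ?xmax.
Qed.

Lemma act_set_eq0 B : (act_set h B == fset0) = (B == fset0).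
Proof.
apply/idP/idP => /eqP B0; last first.
  by rewrite B0; apply/eqP/fsetP => x; apply/imfsetP; rewrite inE => -[].
apply/negP => /negP/fset0Pn[b bB].
by have := in_fset0 (h b); rewrite -B0 in_imfset.
Qed.

Lemma inclusion_maximal_act F B :
  (forall C, C \in F -> C `<=` alts T) -> inclusion_maximal F B ->
  inclusion_maximal (act_family h F) (act_set h B).
Proof.
move=> FT /[dup] Bmax /andP[BF _]; apply/andP; split; first exact: in_imfset.
apply/allP => _ /imfsetP[C /= CF ->]; apply/implyP.
rewrite act_setS ?FT // => BC.
by rewrite (inclusion_maximal_eq Bmax CF BC).
Qed.

Lemma inclusion_maximal_act_inv F B :
  (forall C, C \in F -> C `<=` alts T) -> B \in F ->
  inclusion_maximal (act_family h F) (act_set h B) -> inclusion_maximal F B.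
Proof.
move=> FT BF Bmax; apply/andP; split=> //.
apply/allP => C CF; apply/implyP => BC; apply/eqP.
apply: act_set_inj; rewrite ?FT //.
by apply: (inclusion_maximal_eq Bmax); rewrite ?in_imfset ?act_setS ?FT.
Qed.

End Isomorphism.

(** * Solutions defined by a concept of qualified subsets *)

Section QualifiedConcept.
Variables (X : choiceType) (Q : tournament X -> {fset {fset X}}).
Hypothesis QC : qualified_concept Q.
Implicit Types (T : tournament X) (B C : {fset X}).

Lemma qualified_sub T B : B \in Q T -> B `<=` alts T.
Proof. by move=> /(fsubsetP (qc_Msets QC T)); rewrite in_Msets => /andP[]. Qed.

Lemma qualified_max T B : B \in Q T -> exists a, a \in maxelts T B.
Proof. by move=> /(fsubsetP (qc_Msets QC T)); rewrite in_Msets => /andP[_ /fset0Pn]. Qed.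

Lemma qualified_set1 T a : a \in alts T -> [fset a] \in Q T.
Proof. by move=> aT; apply: (fsubsetP (qc_singletons QC T)); apply/imfsetP; exists a. Qed.

Lemma tournament_function_solution_of :
  tournament_function (@act_set X) (solution_of Q).
Proof.
apply: tournament_function_of_iso; first exact: act_set_id.
move=> T T' h iso; have QT' := (qc_function QC).2 T T' h iso.
apply/fsetP => y; apply/solution_ofP/imfsetP => [[C]|[x /=]].
  rewrite QT' => Cmax; have /andP[/imfsetP[B /= BQ CE] _] := Cmax.
  move: Cmax; rewrite CE (maxelts_act iso (qualified_sub BQ)) => Cmax.
  move=> /imfsetP[x /= xB ->]; exists x => //; apply/solution_ofP; exists B => //.
  exact: (inclusion_maximal_act_inv iso (@qualified_sub T)).
case/solution_ofP=> B Bmax xB ->; exists (act_set h B).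
  by rewrite QT'; apply: (inclusion_maximal_act iso) => //; apply: qualified_sub.
have /andP[/qualified_sub BT _] := Bmax.
by rewrite (maxelts_act iso BT) in_imfset.
Qed.

Lemma tournament_solution_solution_of : tournament_solution (solution_of Q).
Proof.
split=> [|T]; first exact: tournament_function_solution_of.
split.
(* A maximal alternative stays maximal in any inclusion-maximal qualified set extending its
   singleton. *)
- apply/fsubsetP => a aT; have aA := fsubsetP (maxelts_sub T _) a aT.
  have [B Bmax] := exists_inclusion_maximal (qualified_set1 aA).
  rewrite fsub1set => aB; apply/solution_ofP; exists B => //.
  by apply: maxelts_subset aT => //; case/andP: Bmax => /qualified_sub.
- apply/fsubsetP => a /solution_ofP[B /andP[/qualified_sub BT _] aB].
  exact/(fsubsetP BT)/(fsubsetP (maxelts_sub T B)).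
have /fset0Pn[a aT] := alts_neq0 T.
have [B Bmax _] := exists_inclusion_maximal (qualified_set1 aT).
have /andP[/qualified_max[b bB] _] := Bmax.
by apply/fset0Pn; exists b; apply/solution_ofP; exists B.
Qed.

Lemma strongly_retentive_solution_of : strongly_retentive (solution_of Q).
Proof.
move=> T a D0 aT; apply/fsubsetP => b /solution_ofP[B Bmax bB].
have /andP[BQD _] := Bmax.
have BD : B `<=` dominators T a := qualified_sub BQD.
have DT := dominators_sub T a.
(* By Independence, a set of dominators of [a] is qualified in [T] exactly when it is among the
   dominators. *)
have indep C : C `<=` dominators T a -> C \in Q T <-> C \in Q (restrict T D0).
  move=> CD; apply: (qc_independence QC).
  by rewrite fsubsetI CD (fsubset_trans CD).
have BQ : B \in Q T by apply/indep.
have aB : a \notin B.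
  by apply/negP => /(fsubsetP BD); rewrite in_dominators domxx andbF.
have [BaQ|BaQ] := boolP (B `|` [fset a] \in Q T); last first.
  (* Since Fusion of [B] with the singleton of [a] fails, its cardinality proviso must fail: no
     tournament has a qualified set larger than [B], so [B] is already maximal in [T]. *)
  have largest T' C : C \in Q T' -> #|` C| <= #|` B|.
    move=> CQ; rewrite leqNgt; apply: contra BaQ => ltBC.
    apply: (qc_fusion QC) => //; first exact: qualified_set1.
      move=> x y; rewrite !inE => /andP[_ /(fsubsetP BD)].
      by rewrite in_dominators => /andP[_ xa] /eqP->.
    by exists T', C; split=> //; rewrite fsetUC cardfsU1 aB.
  apply/solution_ofP; exists B => //; apply/andP; split=> //.
  apply/allP => C CQ; apply/implyP => BC.
  by rewrite eq_sym eqEfcard BC (largest T).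
have [C Cmax BaC] := exists_inclusion_maximal BaQ.
have [BC aC] : B `<=` C /\ a \in C.
  by move: BaC; rewrite fsubUset fsub1set => /andP[].
have bC : b \in C := fsubsetP BC b (fsubsetP (maxelts_sub T B) b bB).
have ba : dom T b a.
  have := fsubsetP BD b (fsubsetP (maxelts_sub T B) b bB).
  by rewrite in_dominators => /andP[].
have /andP[CQ _] := Cmax; have [c cC] := qualified_max CQ.
have cC' := fsubsetP (maxelts_sub T C) c cC.
(* The maximum [c] of [C] differs from [a], because [b] in [C] dominates [a]. *)
have ca : dom T c a.
  apply: (dom_maxelts cC aC); apply: contraTneq ba => ac.
  by case/in_maxelts: cC => _; rewrite -ac; apply.
(* [E] keeps the maximum [c] of [C], so it is qualified by Closure. It contains [B], so maximality
   of [B] among the dominators gives [E = B] and [c = b]. *)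
pose E := C `&` dominators T a.
have cE : c \in maxelts T E.
  apply: maxelts_subset cC; rewrite ?fsubsetIl // in_fsetI cC' in_dominators ca.
  by rewrite (fsubsetP (qualified_sub CQ)).
have EQ : E \in Q T.
  apply: (qc_closure QC) CQ (fsubsetIl _ _) _.
  rewrite in_Msets (fsubset_trans (fsubsetIr _ _) DT).
  by apply/fset0Pn; exists c.
have EB : E = B.
  apply: inclusion_maximal_eq Bmax _ _; last by rewrite fsubsetI BC.
  by apply/indep => //; apply: fsubsetIr.
apply/solution_ofP; exists C => //.
by rewrite EB in cE; rewrite (maxelts_unique bB cE).
Qed.

End QualifiedConcept.

(** * The Banks set as a solution defined by qualified subsets *)

(* [Mstar] contains [fset0], which no concept of qualified subsets does. *)
Definition Mstar_neq0 (X : choiceType) (T : tournament X) : {fset {fset X}} :=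
  Mstar T `\ fset0.

Lemma in_Mstar_neq0 (X : choiceType) (T : tournament X) (B : {fset X}) :
  (B \in Mstar_neq0 T) = (B != fset0) && (B \in Mstar T).
Proof. by rewrite in_fsetD1. Qed.

Lemma Mstar_iso (X : choiceType) (T T' : tournament X) (h : X -> X)
    (B : {fset X}) :
  isomorphism T T' h -> B `<=` alts T ->
  (act_set h B \in Mstar T') = (B \in Mstar T).
Proof.
move=> iso BT; have subA C : C `<=` B -> C `<=` alts T.
  by move=> CB; apply: fsubset_trans BT.
apply/in_Mstar/in_Mstar => -[BA Bmax]; split=> //.
- move=> C CB; rewrite -(act_set_eq0 h) -(act_set_eq0 h (maxelts T C)).
  rewrite -(maxelts_act iso) ?subA //; apply: Bmax.
  by rewrite (act_setS iso) ?subA.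
- exact: (act_set_sub_alts iso).
move=> D DB.
have [C CT DE] := act_set_preim iso (fsubset_trans DB (act_set_sub_alts iso BT)).
move: DB; rewrite DE (act_setS iso) // (maxelts_act iso) // !act_set_eq0.
exact: Bmax.
Qed.

Lemma Mstar_neq0_qualified (X : choiceType) :
  qualified_concept (@Mstar_neq0 X).
Proof.
have subA (T : tournament X) (B : {fset X}) : B \in Mstar_neq0 T -> B `<=` alts T.
  by rewrite in_Mstar_neq0 => /andP[_ /in_Mstar[]].
split.
- apply: tournament_function_of_iso; first exact: act_family_id.
  move=> T T' h iso; apply/fsetP => D; apply/idP/imfsetP => [DM|[B /= BM ->]].
    have [B BT DE] := act_set_preim iso (subA _ _ DM); exists B => //.
    by move: DM; rewrite DE !in_Mstar_neq0 act_set_eq0 (Mstar_iso iso).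
  move: BM (subA _ _ BM) => /[swap] BT.
  by rewrite !in_Mstar_neq0 act_set_eq0 (Mstar_iso iso).
- move=> T; apply/fsubsetP => _ /imfsetP[a /= aT ->].
  rewrite in_Mstar_neq0 Mstar_set1 // andbT.
  by apply/fset0Pn; exists a; rewrite inE.
- move=> T; apply/fsubsetP => B; rewrite in_Mstar_neq0 in_Msets.
  by move=> /andP[B0 /in_Mstar[-> Bmax]]; apply: Bmax.
- move=> T B C; rewrite !in_Mstar_neq0 in_Msets => /andP[_ BM] CB /andP[_ Cmax].
  rewrite (Mstar_sub BM CB) andbT; apply: contraNneq Cmax => C0.
  by have := maxelts_sub T C; rewrite C0 fsubset0.
- move=> T A' A'0 B; rewrite fsubsetI => /andP[BT BA'].
  rewrite !in_Mstar_neq0.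
  by split=> /andP[-> /in_Mstar[_ Bmax]]; apply/in_Mstar.
move=> T B C; rewrite !in_Mstar_neq0 => /andP[B0 BM] /andP[_ CM] BC _.
by rewrite (Mstar_fusion BM CM BC) fsetU_eq0 negb_and B0.
Qed.

(** Only sets with a maximal element contribute to either union. Such sets are non-empty, and so are
    their supersets, so dropping [fset0] does not affect their maximality. *)
Lemma Banks_Mstar_neq0 (X : choiceType) (T : tournament X) :
  Banks T = solution_of (@Mstar_neq0 X) T.
Proof.
have Mstar_max a B : a \in maxelts T B -> B != fset0.
  by move=> aB; apply/fset0Pn; exists a; apply: (fsubsetP (maxelts_sub T B)).
apply/fsetP => a; apply/solution_ofP/solution_ofP => -[B Bmax aB]; exists B => //.
  have /andP[BM _] := Bmax; rewrite /inclusion_maximal in_Mstar_neq0.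
  rewrite BM (Mstar_max _ _ aB); apply/allP => C; rewrite in_Mstar_neq0.
  by move=> /andP[_ CM]; apply/implyP => /(inclusion_maximal_eq Bmax CM)->.
have /andP[+ _] := Bmax; rewrite in_Mstar_neq0 => /andP[B0 BM].
rewrite /inclusion_maximal BM; apply/allP => C CM; apply/implyP => BC.
apply/eqP/(inclusion_maximal_eq Bmax); rewrite ?in_Mstar_neq0 ?CM ?andbT //.
by apply: contraNneq B0 => C0; move: BC; rewrite C0 fsubset0.
Qed.

(** * Minimality of the Banks set *)

Lemma Banks_sub_strongly_retentive (X : choiceType)
    (S : tournament X -> {fset X}) :
  tournament_solution S -> strongly_retentive S ->
  forall T, Banks T `<=` S T.
Proof.
move=> [_ Ssol] Sret T; have [n] := ubnP #|` alts T|; elim: n T => // n IH T leTn.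
apply/fsubsetP => b /solution_ofP[B Bmax bB]; have /andP[BM _] := Bmax.
have bB' := fsubsetP (maxelts_sub T B) b bB.
have /in_Mstar[BT _] := BM.
have B0 : B != fset0 by apply/fset0Pn; exists b.
have [m mB Bm] := Mstar_minimum BM B0; have mT := fsubsetP BT m mB.
have [mb|mb] := eqVneq m b.
  have [maxT _ _] := Ssol T; apply: (fsubsetP maxT); apply/in_maxelts.
  split=> [|x xT]; first exact: (fsubsetP BT).
  (* Any other element of [B] would dominate its minimum [m = b], which is also its maximum. *)
  have B1 : B = [fset b].
    apply/eqP; rewrite eqEfsubset fsub1set bB' andbT.
    apply/fsubsetP => y yB; rewrite inE; apply/negP => /negP yb.
    have := Bm y m; rewrite !inE mb yb yB eqxx => /(_ isT isT).
    by case/in_maxelts: bB => _ /(_ y yB) /negPf->.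
  apply/negP => xb.
  (* A dominator [x] of [b] could be put on top of [B], against maximality. *)
  have xBM : [fset x] `|` B \in Mstar T.
    apply: Mstar_fusion => //; first exact: Mstar_set1.
    by move=> y z; rewrite B1 !inE => /andP[_ /eqP->] /eqP->.
  have := inclusion_maximal_eq Bmax xBM (fsubsetUr _ _); rewrite B1 => /fsetP/(_ x).
  by rewrite !inE eqxx => /esym/eqP xeqb; rewrite xeqb domxx in xb.
have BmD : B `\ m `<=` dominators T m.
  apply/fsubsetP => x xB; rewrite in_dominators (Bm x m) ?in_fset1 // andbT.
  exact/(fsubsetP BT)/(fsubsetP (fsubsetDl B [fset m])).
have bBm : b \in B `\ m by rewrite !inE eq_sym mb.
have D0 : dominators T m != fset0.
  by apply/fset0Pn; exists b; apply: (fsubsetP BmD).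
apply: (fsubsetP (Sret T m D0 mT)).
apply: (fsubsetP (IH (restrict T D0) _)).
  by apply: leq_trans (fproper_ltn_card (dominators_proper mT)) _.
apply/solution_ofP; exists (B `\ m); last first.
  exact: maxelts_subset (fsubsetDl _ _) bBm bB.
apply/andP; split.
  (* [restrict] keeps the dominance relation, so transitivity carries over and only the inclusion in
     the alternatives is new. *)
  by have /in_Mstar[_ ?] := Mstar_sub BM (fsubsetDl B [fset m]); apply/in_Mstar.
apply/allP => C /in_Mstar[CD Cmax]; apply/implyP => BC.
have mC : m \notin C.
  by apply/negP => /(fsubsetP CD); rewrite in_dominators domxx andbF.
(* Putting [m] back below [C] gives a transitive set containing [B], hence equal to [B]; as [m] is
   not in [C], removing it again recovers [C]. *)
have CmM : C `|` [fset m] \in Mstar T.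
  apply: Mstar_fusion; last 2 first.
  - exact: Mstar_set1.
  - move=> x y; rewrite !inE => /andP[_ /(fsubsetP CD)].
    by rewrite in_dominators => /andP[_ xm] /eqP->.
  by apply/in_Mstar; split=> //; apply: fsubset_trans CD (dominators_sub T m).
have CmB : C `|` [fset m] = B.
  apply: inclusion_maximal_eq Bmax CmM _.
  by rewrite -(fsetD1K mB) fsetUC fsetSU.
apply/eqP/fsetP => x; rewrite -CmB !inE.
by have [->|] := eqVneq x m; rewrite ?orbF //= (negPf mC).
Qed.

Theorem theorem1 (X : choiceType) :
  [/\ strongly_retentive (@Banks X),
      forall S : tournament X -> {fset X},
        tournament_solution S -> strongly_retentive S ->
        forall T : tournament X, Banks T `<=` S T,
      forall Q : tournament X -> {fset {fset X}},
        qualified_concept Q ->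
        forall T : tournament X, Banks T `<=` solution_of Q T
    & tournament_solution (@Banks X) /\
      definable_by_qualified_subsets (@Banks X)].
Proof.
have QM := @Mstar_neq0_qualified X.
have BE := @Banks_Mstar_neq0 X.
have [Sfun Ssol] := tournament_solution_solution_of QM.
split.
- by move=> T a D0 aT; rewrite !BE; apply: strongly_retentive_solution_of.
- exact: Banks_sub_strongly_retentive.
(* [solution_of Q] is itself a strongly retentive tournament solution, so minimality applies to
   it. *)
- move=> Q QC; apply: Banks_sub_strongly_retentive.
    exact: tournament_solution_solution_of.
  exact: strongly_retentive_solution_of.
split; last by exists (@Mstar_neq0 X).
split=> [|T]; last by rewrite BE.
split=> [T T'|T T' h]; rewrite !BE; [exact: Sfun.1|exact: Sfun.2].
Qed.
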